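(* For all integers $n\ge 2$, $k\ge 0$ and $0\le j\le n-1$, $$|OLA^+_{P_n}(k,j)|\le 2^{0.119n+1.96k-0.967095j+2}.$$ Furthermore, with $d_2=0.497534$, $$|OLA^+_{P_n}(k,2)|\le (1-d_2)\,2^{0.119n+1.96k-2\cdot 0.967095+2}.$$
   Context: Let $P_n=p_1p_2\dots p_n$ be a path on $n$ vertices. A linear arrangement of $P_n$ is a bijection $\alpha:V(P_n)\to\{1,\dots,n\}$, and its net cost is $\sum_{i=1}^{n-1}(|\alpha(p_i)-\alpha(p_{i+1})|-1)$. For nonnegative integers $k,j$, $OLA^+_{P_n}(k,j)$ denotes the set of linear arrangements $\alpha$ of $P_n$ with net cost at most $k$ such that $\alpha(p_1)=j$ and $\alpha(p_n)=n$. *)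

(* Defs.v *)
From mathcomp Require Import all_boot all_fingroup.
From mathcomp Require Import ssrint.

Set Implicit Arguments.
Unset Strict Implicit.
Unset Printing Implicit Defensive.

(* The vertex p_i of P_n is the ordinal of value i - 1, and the linear
   arrangement alpha encoded by a : {perm 'I_n} sends v to position
   (a v).+1 in {1, ..., n}. *)
Definition position (n : nat) (a : {perm 'I_n}) (v : 'I_n) : nat := (a v).+1.

(* The inner sum ranges over the successor of u on the path (if any).  Since a
   is injective, positions differ and the truncated "- 1" is exact. *)
Definition net_cost (n : nat) (a : {perm 'I_n}) : nat :=
  \sum_(u : 'I_n) \sum_(v : 'I_n | v == u.+1 :> nat)
     (`|position a u - position a v| - 1).

Definition OLAplus (n k j : nat) : {set {perm 'I_n}} :=
  [set a : {perm 'I_n} |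
    [&& net_cost a <= k,
        [forall v : 'I_n, (v == 0 :> nat) ==> (position a v == j)]
      & [forall v : 'I_n, (v == n.-1 :> nat) ==> (position a v == n)]]].

(* Main.v *)
(* Deleting p_1 from an arrangement of P_n leaves an arrangement of p_2 ... p_n
   that still ends at the last position.  If p_1 stood at j and p_2 lands at i,
   the net cost drops by the excess of the edge p_1 p_2 plus the number of
   remaining edges jumping over the deleted position; since the shortened path
   ends to the right of j, that number is at least 1 if i < j, and at least 2
   if i >= j and some position lies to the left of j.  Iterating gives a finite
   list containing every arrangement, whose size obeys an explicit recursion.
   The bound 2^(0.119 n + 1.96 k - 0.967095 j + 2), with the extra factor
   1 - d_2 at j = 2, is a supersolution of that recursion: this reduces to
   three inequalities between geometric series, one each for j = 1, j = 2 and
   j >= 3, which hold with margins of order 10^-5. *)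
Require Import Defs.
From Stdlib Require Import Reals Lra.
From Coquelicot Require Import Coquelicot.
From mathcomp Require Import all_boot all_fingroup.
From mathcomp Require Import ssrint zify.

Local Open Scope nat_scope.

(** * Arrangements as lists of positions, counted from 0 *)

Fixpoint path_cost (x : nat) (s : seq nat) : nat :=
  if s is y :: s' then (`|x - y| - 1) + path_cost y s' else 0.

Fixpoint crossings (j x : nat) (s : seq nat) : nat :=
  if s is y :: s' then ((x < j) != (y < j)) + crossings j y s' else 0.

(** Here [i] is counted after deletion of [j], so the lost edge has excess [j - i - 1] if [i < j]
    and [i - j] otherwise; the three branches add 1, 0 and 2 jumping edges. *)
Definition removal_cost (j i : nat) : nat :=
  if i < j then j - i else if j == 0 then i else i - j + 2.

(* Arrangements of m + 1 vertices; for j > m this may contain spurious lists,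
   which is harmless since only an upper bound on the size is needed. *)
Fixpoint arrangements (m k j : nat) : seq (seq nat) :=
  if m is m'.+1 then
    [seq j :: map (bump j) t | i <- iota 0 m,
       t <- if removal_cost j i <= k then arrangements m' (k - removal_cost j i) i
            else [::]]
  else if j == 0 then [:: [:: 0]] else [::].

(** Reinserting position [j] lengthens by one exactly the edges straddling it; by [uniq] no edge has
    length 0, so the truncated [- 1] is harmless. *)
Lemma path_cost_bump (j x : nat) (s : seq nat) : uniq (x :: s) ->
  path_cost (bump j x) (map (bump j) s) = path_cost x s + crossings j x s.
Proof.
elim: s x => [|y s IH] x //= /andP[]; rewrite inE negb_or => /andP[xy _] ys.
rewrite {}IH // addnACA; congr (_ + _).
rewrite /bump; case: (leqP j x); case: (leqP j y) => ? ?; lia.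
Qed.

Lemma crossings_lt_last (j x : nat) (s : seq nat) :
  x < j -> j <= last x s -> 0 < crossings j x s.
Proof.
elim: s x => [|y s IH] x /= xj jl; first lia.
by case: (ltnP y j) => [yj|_]; rewrite ?xj //= IH.
Qed.

(** The path has to go down to [y] and come back up. *)
Lemma crossings_ge_last (j x y : nat) (s : seq nat) :
  j <= x -> j <= last x s -> y \in s -> y < j -> 1 < crossings j x s.
Proof.
elim: s x => [|z s IH] x //= jx jl; rewrite inE => /predU1P yzs yj.
rewrite (leq_gtF jx); have [zj|jz] := ltnP z j.
  by rewrite /= ltnS crossings_lt_last.
by apply: IH => //; case: yzs => // yz; lia.
Qed.

Lemma path_cost_remove (j i m : nat) (t : seq nat) :
  uniq (i :: t) -> size t = m -> all (leq^~ m) (i :: t) ->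
  last i t = m -> j <= m ->
  path_cost i t + removal_cost j i <= path_cost j (map (bump j) (i :: t)).
Proof.
move=> uit st ait lt jm /=.
rewrite path_cost_bump // /removal_cost /bump.
case: (ltnP i j) => [ij|ji].
  have : 0 < crossings j i t by apply: crossings_lt_last; rewrite ?lt.
  lia.
case: (posnP j) => [->|j0]; first lia.
(* By counting, the [m + 1] distinct entries fill [0..m], so position 0, to the left of [j], is
   visited. *)
have z_it : 0 \in i :: t.
  have sub : {subset i :: t <= iota 0 m.+1}.
    by move=> z zit; rewrite mem_iota add0n ltnS /=; apply: (allP ait).
  have [|_ ->] := uniq_min_size uit sub; last by rewrite mem_iota.
  by rewrite size_iota /= st.
have zt : 0 \in t by move: z_it; rewrite inE => /predU1P[|//]; lia.
have : 1 < crossings j i t by apply: (@crossings_ge_last _ _ 0); rewrite ?lt.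
lia.
Qed.

Lemma mem_arrangements (m k j : nat) (s : seq nat) :
  uniq (j :: s) -> size s = m -> all (leq^~ m) (j :: s) -> last j s = m ->
  path_cost j s <= k -> j :: s \in arrangements m k j.
Proof.
elim: m k j s => [|m IH] k j s.
  by move=> _ /size0nil -> _ /= ->.
case: s => [|i0 s] // ujs [ss] ajs ls cs.
set t := map (unbump j) (i0 :: s).
have jNs : j \notin i0 :: s by case/andP: ujs.
have tK : map (bump j) t = i0 :: s.
  rewrite /t -map_comp -[RHS]map_id; apply/eq_in_map => z zs.
  by rewrite /= unbumpKcond (negbTE (memPn jNs _ zs)).
(* The last vertex, distinct from the first, occupies [m + 1]. *)
have jm : j <= m.
  have := mem_last i0 s; rewrite /= in ls; rewrite ls => mS.
  have /= := memPn jNs _ mS; case/andP: ajs; lia.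
have ut : uniq t by apply: (@map_uniq _ _ (bump j)); rewrite tK; case/andP: ujs.
have at_ : all (leq^~ m) t.
  apply/allP => _ /mapP[z zs ->].
  have zm : z <= m.+1 by apply: (allP ajs); rewrite inE zs orbT.
  rewrite /unbump; have := memPn jNs _ zs; case: ltnP; lia.
have lt : last (unbump j i0) (map (unbump j) s) = m.
  by rewrite last_map; move: ls => /= ->; rewrite /unbump; lia.
have := @path_cost_remove j (unbump j i0) m (map (unbump j) s) ut _ at_ lt jm.
rewrite size_map => /(_ ss).
rewrite -[unbump j i0 :: _]/t tK => /leq_trans/(_ cs) ck.
rewrite -tK; apply/allpairsPdep; exists (unbump j i0), t; split => //.
  by rewrite mem_iota add0n ltnS /=; case/andP: at_.
have rk : removal_cost j (unbump j i0) <= k := leq_trans (leq_addl _ _) ck.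
rewrite rk; apply: IH => //; first by rewrite size_map.
by rewrite -(leq_add2r (removal_cost j (unbump j i0))) subnK.
Qed.

(** * Permutations as lists of positions *)

Lemma path_costE (x : nat) (s : seq nat) :
  path_cost x s =
  \sum_(i < size s) (`|nth 0 (x :: s) i - nth 0 (x :: s) i.+1| - 1).
Proof.
elim: s x => [|y s IH] x /=; first by rewrite big_ord0.
by rewrite big_ord_recl IH.
Qed.

Definition values (n : nat) (a : {perm 'I_n}) : seq nat :=
  [seq val (a v) | v <- enum 'I_n].

Lemma nth_values (n : nat) (a : {perm 'I_n}) (v : 'I_n) :
  nth 0 (values n a) v = a v.
Proof. by rewrite (nth_map v) ?size_enum_ord // nth_ord_enum. Qed.

Lemma size_values (n : nat) (a : {perm 'I_n}) : size (values n a) = n.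
Proof. by rewrite size_map size_enum_ord. Qed.

Lemma values_inj (n : nat) : injective (values n).
Proof.
by move=> a b ab; apply/permP => v; apply: val_inj; rewrite /= -!nth_values ab.
Qed.

Lemma net_costE (m : nat) (a : {perm 'I_m.+1}) :
  net_cost a =
  \sum_(i < m) (`|nth 0 (values m.+1 a) i - nth 0 (values m.+1 a) i.+1| - 1).
Proof.
(* The last vertex has no successor, so its inner sum is empty. *)
rewrite /net_cost big_ord_recr /= [X in _ + X]big_pred0 ?addn0; last first.
  by move=> v; have := ltn_ord v; lia.
apply: eq_bigr => i _.
rewrite (big_pred1 (lift ord0 i)); last by move=> v; rewrite /= -val_eqE.
rewrite /position -(nth_values _ a (widen_ord _ i)) -(nth_values _ a (lift ord0 i)).
by rewrite /= /bump /= add1n; lia.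
Qed.

Lemma values_arrangements (m k j : nat) (a : {perm 'I_m.+1}) :
  a \in OLAplus m.+1 k j.+1 -> values m.+1 a \in arrangements m k j.
Proof.
rewrite inE => /and3P[ck /forallP/(_ ord0)/= /eqP hd /forallP/(_ ord_max)].
rewrite eqxx /= => /eqP tl.
have := size_values _ a; have := net_costE _ a; have := nth_values _ a ord0.
have := nth_values _ a ord_max.
have : uniq (values m.+1 a).
  by rewrite map_inj_uniq ?enum_uniq // => u v /val_inj/perm_inj.
have : all (leq^~ m) (values m.+1 a).
  by apply/allP => _ /mapP[v _ ->]; rewrite /= -ltnS ltn_ord.
case: (values m.+1 a) => [|x s] // axs uxs ntl /= nhd ccost [ss].
have xj : x = j by case: hd => <-.
rewrite {x nhd}xj in axs uxs ntl ccost *; apply: mem_arrangements => //.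
  by rewrite -[last j s]/(last 0 (j :: s)) -nth_last /= ss ntl; case: tl.
by rewrite path_costE ss -ccost.
Qed.

Lemma card_OLAplus_le (m k j : nat) :
  #|OLAplus m.+1 k j.+1| <= size (arrangements m k j).
Proof.
rewrite cardE -(size_map (values m.+1)); apply: uniq_leq_size.
  by rewrite map_inj_uniq ?enum_uniq //; apply: values_inj.
by move=> _ /mapP[a + ->]; rewrite mem_enum; apply: values_arrangements.
Qed.

Lemma card_OLAplus0 (m k : nat) : #|OLAplus m.+1 k 0| = 0.
Proof.
apply: eq_card0 => a; rewrite inE; apply/negP => /and3P[_ /forallP/(_ ord0)].
by [].
Qed.

Lemma size_arrangementsS (m k j : nat) :
  size (arrangements m.+1 k j) =
  \sum_(i < m.+1) if removal_cost j i <= k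
                  then size (arrangements m (k - removal_cost j i) i) else 0.
Proof.
rewrite {1}/arrangements -/arrangements size_allpairs_dep sumnE big_map -[m.+1]subn0.
rewrite -/(index_iota 0 m.+1) big_mkord; apply: eq_bigr => i _.
by case: ifP.
Qed.

Local Open Scope R_scope.

(** * The recursion and its supersolution *)

Fixpoint rsum (g : nat -> R) (n : nat) : R :=
  if n is n'.+1 then rsum g n' + g n' else 0.

Lemma INR_sum_le (n : nat) (f : nat -> nat) (g : nat -> R) :
  (forall i, (i < n)%N -> INR (f i) <= g i) ->
  INR (\sum_(i < n) f i) <= rsum g n.
Proof.
elim: n => [|n IH] fg; first by rewrite big_ord0; apply: Rle_refl.
rewrite big_ord_recr /= plus_INR; apply: Rplus_le_compat; last exact: fg.
by apply: IH => i ni; apply: fg; apply: ltnW.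
Qed.

Lemma rsum_le (g h : nat -> R) (n : nat) :
  (forall i, g i <= h i) -> rsum g n <= rsum h n.
Proof.
by move=> gh; elim: n => [|n IH] /=; [apply: Rle_refl | apply: Rplus_le_compat].
Qed.

Lemma rsumZ (c : R) (g : nat -> R) (n : nat) :
  rsum (fun i => c * g i) n = c * rsum g n.
Proof. by elim: n => [|n /= ->]; rewrite /=; ring. Qed.

(* Positions are counted from 0 here, so the improved case is j = 1. *)
Definition weight (d : R) (j : nat) : R := if j == 1%N then 1 - d else 1.

(** Factor by which [b ^ k * g ^ j] changes when the first vertex is deleted, for [x = 1/(b g)],
    [y = g/b], [u = 1/b^2]; [u] pays for the two jumping edges. *)
Definition ratio (x y u : R) (j i : nat) : R :=
  if (i < j)%N then x ^ (j - i)
  else if j == 0%N then y ^ i else u * y ^ (i - j).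

Lemma ratioE (b g : R) (j i k : nat) : 0 < b -> 0 < g ->
  (removal_cost j i <= k)%N ->
  b ^ (k - removal_cost j i) * g ^ i =
  b ^ k * g ^ j * ratio (/ (b * g)) (g / b) (/ b ^ 2) j i.
Proof.
move=> b0 g0 dk; rewrite -{2}(subnK dk) pow_add.
have powN z n : 0 < z -> z ^ n <> 0 by move=> z0; apply: pow_nonzero; lra.
move: (k - _)%N => l {dk}; rewrite /ratio /removal_cost.
case: (ltnP i j) => [ij|ji].
  rewrite -{2}(subnK (ltnW ij)) pow_add pow_inv Rpow_mult_distr.
  by field; split; apply: powN.
case: (posnP j) => [->|j0].
  by rewrite Rpow_mult_distr pow_inv /=; field; apply: powN.
rewrite -{1}(subnK ji) !pow_add Rpow_mult_distr pow_inv.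
by field; split; [apply: powN | lra].
Qed.

(** A full geometric series, from which the reduced weight at [i = 1] takes [d * y]. The closed form
    contains that term, hence starts at two terms. *)
Lemma rsum_weight_ratio_0 (x y u d : R) (n : nat) : 0 <= y < 1 -> 0 <= d <= 1 ->
  rsum (fun i => weight d i * ratio x y u 0 i) n <= / (1 - y) - d * y.
Proof.
move=> y01 d01.
have g1 : / (1 - y) * (1 - y) = 1 by field; lra.
have g0 : 0 < / (1 - y) by apply: Rinv_0_lt_compat; lra.
case: n => [|[|n]]; rewrite /=; try by rewrite /weight /ratio /=; nra.
have -> : rsum (fun i => weight d i * ratio x y u 0 i) n + weight d n * ratio x y u 0 n
   + weight d n.+1 * ratio x y u 0 n.+1 = / (1 - y) * (1 - y ^ n.+2) - d * y.
  elim: n => [|n /= ->]; rewrite /weight /ratio /=; field; lra.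
have : 0 <= y ^ n.+2 by apply: pow_le; lra.
nra.
Qed.

Lemma rsum_weight_ratio_1 (x y u d : R) (n : nat) :
  0 <= x -> 0 <= y < 1 -> 0 <= u -> 0 <= d <= 1 ->
  rsum (fun i => weight d i * ratio x y u 1 i) n <= x + u * (/ (1 - y) - d).
Proof.
move=> x0 y01 u0 d01.
have g1 : / (1 - y) * (1 - y) = 1 by field; lra.
have g0 : 0 < / (1 - y) by apply: Rinv_0_lt_compat; lra.
have gd : 0 <= u * (/ (1 - y) - d) by apply: Rmult_le_pos => //; nra.
case: n => [|[|n]]; rewrite /=; try by rewrite /weight /ratio /=; nra.
have -> : rsum (fun i => weight d i * ratio x y u 1 i) n + weight d n * ratio x y u 1 n
   + weight d n.+1 * ratio x y u 1 n.+1
   = x + u * (/ (1 - y) * (1 - y ^ n.+1) - d).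
  elim: n => [|n /= ->]; first by rewrite /weight /ratio /=; field; lra.
  by rewrite /weight /ratio ?subSS ?subn0 /=; field; lra.
have : 0 <= y ^ n.+1 by apply: pow_le; lra.
move=> yn; apply: Rplus_le_compat_l; apply: Rmult_le_compat_l => //; nra.
Qed.

Lemma rsum_ratio_le (x y u : R) (j n : nat) :
  0 < x < 1 -> 0 <= y < 1 -> 0 <= u -> (0 < j)%N ->
  rsum (ratio x y u j) n <= x / (1 - x) + u / (1 - y).
Proof.
move=> x01 y01 u0 j0.
have g0 : 0 < / (1 - y) by apply: Rinv_0_lt_compat; lra.
have h0 : 0 < / (1 - x) by apply: Rinv_0_lt_compat; lra.
(* Read downwards from [i = p - 1], the terms begin a geometric series with first term
   [x ^ (j - p) * x]. *)
have left_part p : (p <= j)%N -> rsum (ratio x y u j) p <= x ^ (j - p) * (x / (1 - x)).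
  elim: p => [|p IH] pj /=.
    apply: Rmult_le_pos; first by apply: pow_le; lra.
    by apply: Rmult_le_pos; lra.
  rewrite {2}/ratio pj; have := IH (ltnW pj); rewrite -(subnSK pj) /=.
  move: (x ^ _) => z; rewrite /Rdiv => le_z.
  have -> : z * (x * / (1 - x)) = x * z * (x * / (1 - x)) + x * z by field; lra.
  lra.
have [nj|jn] := leqP n j.
  apply: Rle_trans (left_part _ nj) _.
  have : x ^ (j - n) <= 1 by rewrite -(pow1 (j - n)); apply: pow_incr; lra.
  have : 0 <= x / (1 - x) by apply: Rmult_le_pos; lra.
  have : 0 <= u / (1 - y) by apply: Rmult_le_pos; lra.
  nra.
have right_part p : rsum (ratio x y u j) (j + p) <=
    x / (1 - x) + u / (1 - y) * (1 - y ^ p).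
  elim: p => [|p IH].
    by rewrite addn0; have := left_part j (leqnn _); rewrite subnn /=; lra.
  rewrite addnS /= {2}/ratio ltnNge leq_addr /= addKn (gtn_eqF j0).
  have -> : u / (1 - y) * (1 - y * y ^ p) = u / (1 - y) * (1 - y ^ p) + u * y ^ p.
    by field; lra.
  lra.
rewrite -(subnKC (ltnW jn)); apply: Rle_trans (right_part _) _.
have : 0 <= y ^ (n - j) by apply: pow_le; lra.
have : 0 <= u / (1 - y) by apply: Rmult_le_pos; lra.
nra.
Qed.

(** The constants are a lower bound for 2^0.119 and upper bounds for 2^(-0.992905), 2^(-2.927095)
    and 2^(-3.92). *)
Lemma rsum_weight_ratio_le (P x y u : R) (j n : nat) :
  1.0859818 <= P -> 0 < x <= 0.502466 -> 0 < y <= 0.13148 ->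
  0 < u <= 0.0660637 ->
  rsum (fun i => weight 0.497534 i * ratio x y u j i) n <= weight 0.497534 j * P.
Proof.
move=> P0 x0 y0 u0.
have g : / (1 - y) <= / (1 - 0.13148) by apply: Rinv_le_contravar; lra.
have h : / (1 - x) <= / (1 - 0.502466) by apply: Rinv_le_contravar; lra.
have g0 : 0 < / (1 - y) by apply: Rinv_0_lt_compat; lra.
have h0 : 0 < / (1 - x) by apply: Rinv_0_lt_compat; lra.
have g1 : / (1 - y) = 1 + y * / (1 - y) by field; lra.
have h1 : x * / (1 - x) = / (1 - x) - 1 by field; lra.
case: j => [|[|j]].
- apply: Rle_trans; first by apply: rsum_weight_ratio_0; lra.
  rewrite /weight /=.
  (* After this expansion the bound reads [1 + (1 - d) y + y^2 / (1 - y)], increasing in [y] term by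
     term. *)
  have -> : / (1 - y) = 1 + y + y * (y * / (1 - y)) by rewrite {1}g1 {1}g1; ring.
  have : y * (y * / (1 - y)) <= 0.13148 * (0.13148 * / (1 - 0.13148)).
    have : 0 <= y * / (1 - y) by apply: Rmult_le_pos; lra.
    by move=> yg; apply: Rmult_le_compat; lra.
  lra.
- apply: Rle_trans; first by apply: rsum_weight_ratio_1; lra.
  rewrite /weight /=.
  have : u * (/ (1 - y) - 0.497534) <= 0.0660637 * (/ (1 - 0.13148) - 0.497534).
    by apply: Rmult_le_compat; nra.
  lra.
(* From here on the gain at [i = 1] is given up: all weights are bounded by 1. *)
apply: (Rle_trans _ (rsum (ratio x y u j.+2) n)).
  apply: rsum_le => i; rewrite -{2}(Rmult_1_l (ratio _ _ _ _ _)).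
  apply: Rmult_le_compat_r; last by rewrite /weight; case: ifP; lra.
  rewrite /ratio; case: ifP => _; first by apply: pow_le; lra.
  by apply: Rmult_le_pos; [lra|apply: pow_le; lra].
apply: Rle_trans; first by apply: rsum_ratio_le => //; lra.
rewrite /weight /=.
have : u * / (1 - y) <= 0.0660637 * / (1 - 0.13148) by apply: Rmult_le_compat; lra.
rewrite /Rdiv h1; lra.
Qed.

(** [K * P >= 1] covers the one-vertex path; each further vertex costs a factor [P] by the series
    bound. *)
Lemma size_arrangements_le (K P b g : R) (m k j : nat) :
  1 <= K * P -> 1.0859818 <= P -> 1 <= b -> 0 < g ->
  / (b * g) <= 0.502466 -> g / b <= 0.13148 -> / b ^ 2 <= 0.0660637 ->
  INR (size (arrangements m k j)) <=
  weight 0.497534 j * (K * P ^ m.+1 * b ^ k * g ^ j).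
Proof.
move=> KP P1 b1 g0 hx hy hu.
have K0 : 0 < K by nra.
have bk0 l : 0 < b ^ l by apply: pow_lt; lra.
have gk0 l : 0 < g ^ l by apply: pow_lt; lra.
have Pk0 l : 0 < P ^ l by apply: pow_lt; lra.
have w0 i : 0 < weight 0.497534 i by rewrite /weight; case: ifP; lra.
have bound0 l i i' p : 0 <= weight 0.497534 i * (K * P ^ p * b ^ l * g ^ i').
  by apply/Rlt_le; do ![apply: Rmult_lt_0_compat].
elim: m k j => [|m IH] k j.
  case: j => [|j]; last exact: bound0.
  have : 1 <= b ^ k by apply: pow_R1_Rle.
  by rewrite /weight /=; nra.
rewrite size_arrangementsS.
pose r i := ratio (/ (b * g)) (g / b) (/ b ^ 2) j i.
pose C := K * P ^ m.+1 * b ^ k * g ^ j.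
have C0 : 0 < C by do ![apply: Rmult_lt_0_compat => //].
have bg0 : 0 < / (b * g) by apply: Rinv_0_lt_compat; nra.
have gb0 : 0 < g / b by apply: Rdiv_lt_0_compat; lra.
have u0 : 0 < / b ^ 2 by apply: Rinv_0_lt_compat.
apply: (Rle_trans _ (rsum (fun i => C * (weight 0.497534 i * r i)) m.+1)).
  apply: (INR_sum_le m.+1 (fun i => if (removal_cost j i <= k)%N
    then size (arrangements m (k - removal_cost j i) i) else 0%N)) => i _.
  case: ifP => [rk|_].
    apply: Rle_trans (IH _ _) _; apply: Req_le.
    rewrite (Rmult_assoc (K * _)) ratioE //; last lra.
    by rewrite /C /r; ring.
  (* An [i] beyond the budget contributes 0, below its nonnegative term in the series. *)
  apply: Rmult_le_pos; first lra.
  apply: Rmult_le_pos; first by have := w0 i; lra.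
  rewrite /r /ratio; case: ifP => _; first by apply: pow_le; lra.
  case: ifP => _; first by apply: pow_le; lra.
  by apply: Rmult_le_pos; [lra | apply: pow_le; lra].
rewrite rsumZ.
apply: (Rle_trans _ (C * (weight 0.497534 j * P))).
  apply: Rmult_le_compat_l; first lra.
  by apply: rsum_weight_ratio_le; lra.
by apply: Req_le; rewrite /C /=; ring.
Qed.

(** * Numerical bounds on powers of 2 *)

Lemma exp_taylor_le (N : nat) (t : R) :
  0 <= t -> sum_f_R0 (fun i => / INR (Factorial.fact i) * t ^ i) N <= exp t.
Proof.
move=> t0; apply: sum_incr.
  by rewrite /exp; case: (exist_exp t).
move=> i; apply: Rmult_le_pos; last exact: pow_le.
by apply/Rlt_le/Rinv_0_lt_compat/INR_fact_lt_0.
Qed.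

(* Truncation of ln ((1 + s) / (1 - s)) = 2 (s + s^3/3 + s^5/5 + ...) at
   s = 1/3; the remainder has nonnegative derivative 2 s^14 / (1 - s^2). *)
Lemma ln2_lower : 0.6931471 <= ln 2.
Proof.
pose f s := ln (1 + s) - ln (1 - s)
  - 2 * (s + s^3/3 + s^5/5 + s^7/7 + s^9/9 + s^11/11 + s^13/13).
have e01 : Rmin 0 (1/3) = 0 /\ Rmax 0 (1/3) = 1/3.
  by split; [apply: Rmin_left | apply: Rmax_right]; lra.
case: (MVT_gen f 0 (1/3) (fun s => 2 * s ^ 14 / (1 - s ^ 2))); case: e01 => -> ->.
- move=> x hx; rewrite /f; auto_derive; first lra.
  by field; repeat split; nra.
- move=> x hx; apply/continuity_pt_filterlim/(ex_derive_continuous f).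
  by rewrite /f; auto_derive; lra.
move=> c [hc e].
have : 0 <= 2 * c ^ 14 / (1 - c ^ 2) * (1/3 - 0).
  apply: Rmult_le_pos; last lra.
  apply: Rmult_le_pos; last by apply/Rlt_le/Rinv_0_lt_compat; nra.
  by apply: Rmult_le_pos; [lra | apply: pow_le; lra].
rewrite -e /f Rplus_0_r Rminus_0_r ln_1.
have -> : ln 2 = ln (1 + 1/3) - ln (1 - 1/3).
  by rewrite -ln_div; [congr ln; field | lra | lra].
lra.
Qed.

(** Taking an [M]-th root keeps [s] small, so that the degree 5 Taylor polynomial of exp, in Horner
    form, is sharp enough. *)
Lemma Rpower2_lower (q r : R) (M : nat) :
  (0 < M)%N -> 0 <= q -> 0 <= r ->
  (let s := q * 0.6931471 / INR M in
   r <= 1 + s * (1 + s / 2 * (1 + s / 3 * (1 + s / 4 * (1 + s / 5))))) ->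
  r ^ M <= Rpower 2 q.
Proof.
move=> M0 q0 r0; cbv zeta; set s := q * _ / _ => hr.
have M0' : 0 < INR M by apply: lt_0_INR; lia.
have s0 : 0 <= s by apply: Rmult_le_pos; [lra | apply/Rlt_le/Rinv_0_lt_compat].
have hs : r <= exp s by apply: Rle_trans (exp_taylor_le 5 s s0); rewrite /=; lra.
apply: (Rle_trans _ (exp s ^ M)); first exact: pow_incr.
rewrite -Rpower_pow; last exact: exp_pos.
rewrite /Rpower ln_exp.
have -> : INR M * s = q * 0.6931471 by rewrite /s; field; lra.
have [h|->] : q * 0.6931471 <= q * ln 2; last exact: Rle_refl.
  by apply: Rmult_le_compat_l => //; apply: ln2_lower.
exact/Rlt_le/exp_increasing.
Qed.

Lemma Rpower2_0_119_lower : 1.0859818 <= Rpower 2 0.119.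
Proof.
rewrite -(pow_1 1.0859818).
by apply: Rpower2_lower; rewrite /=; try lra.
Qed.

(** The exponents here and in the next two lemmas are 1.96 - 0.967095, 1.96 + 0.967095 and 2 * 1.96,
    those of [b * g], [b / g] and [b ^ 2]. *)
Lemma Rpower2_0_992905_lower : / 0.502466 <= Rpower 2 0.992905.
Proof.
(* A decimal between the eighth root of 1/0.502466 and the Taylor bound. *)
apply: (Rle_trans _ (1.08983754 ^ 8)); first lra.
by apply: Rpower2_lower; rewrite /=; try lra.
Qed.

Lemma Rpower2_2_927095_lower : / 0.13148 <= Rpower 2 2.927095.
Proof.
apply: (Rle_trans _ (1.06545651 ^ 32)); first lra.
by apply: Rpower2_lower; rewrite /=; try lra.
Qed.

Lemma Rpower2_3_92_lower : / 0.0660637 <= Rpower 2 3.92.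
Proof.
apply: (Rle_trans _ (1.08861963 ^ 32)); first lra.
by apply: Rpower2_lower; rewrite /=; try lra.
Qed.

Lemma Rpower2_INR (c : R) (n : nat) : Rpower 2 c ^ n = Rpower 2 (c * INR n).
Proof. by rewrite -Rpower_pow ?Rpower_mult //; apply: exp_pos. Qed.

Lemma Rpower2_gt0 (c : R) : 0 < Rpower 2 c.
Proof. exact: exp_pos. Qed.

Lemma Rpower2_ge1 (c : R) : 0 <= c -> 1 <= Rpower 2 c.
Proof. by move=> c0; rewrite -(Rpower_O 2); [apply: Rle_Rpower; lra | lra]. Qed.

Lemma Rpower2_inv_le (c v : R) : 0 < v -> / v <= Rpower 2 c -> Rpower 2 (- c) <= v.
Proof.
move=> v0 vc; rewrite Rpower_Ropp -(Rinv_inv v).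
by apply: Rinv_le_contravar => //; apply: Rinv_0_lt_compat.
Qed.

(** * The bound for linear arrangements *)

Lemma card_OLAplusS_le (m k j : nat) :
  INR #|OLAplus m.+1 k j.+1| <=
  weight 0.497534 j *
  Rpower 2 (0.119 * INR m.+1 + 1.96 * INR k - 0.967095 * INR j.+1 + 2).
Proof.
apply: (Rle_trans _ (INR (size (arrangements m k j)))).
  by apply: le_INR; apply/leP; apply: card_OLAplus_le.
(* Passing from [j.+1] to [j] leaves the constant 2 - 0.967095 = 1.032905, the exponent of [K]. *)
have -> : 0.119 * INR m.+1 + 1.96 * INR k - 0.967095 * INR j.+1 + 2 =
    1.032905 + 0.119 * INR m.+1 + 1.96 * INR k + (- 0.967095) * INR j.
  by rewrite (S_INR j); lra.
rewrite !Rpower_plus -!Rpower2_INR; apply: size_arrangements_le.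
- by rewrite -Rpower_plus; apply: Rpower2_ge1; lra.
- exact: Rpower2_0_119_lower.
- by apply: Rpower2_ge1; lra.
- exact: Rpower2_gt0.
- rewrite -Rpower_plus -Rpower_Ropp; apply: Rpower2_inv_le; first lra.
  rewrite [X in Rpower _ X](_ : _ = 0.992905); last lra.
  exact: Rpower2_0_992905_lower.
- rewrite /Rdiv -Rpower_Ropp -Rpower_plus.
  rewrite [X in Rpower _ X](_ : _ = - (2.927095)); last lra.
  by apply: Rpower2_inv_le; [lra | exact: Rpower2_2_927095_lower].
rewrite Rpower2_INR -Rpower_Ropp; apply: Rpower2_inv_le; first lra.
have -> : 1.96 * INR 2 = 3.92 by rewrite /=; lra.
exact: Rpower2_3_92_lower.
Qed.

Theorem theorem3p2 (n k : nat) (hn : (2 <= n)%N) :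
  (forall j : nat, (j <= n - 1)%N ->
     INR #|OLAplus n k j|
       <= Rpower 2 (0.119 * INR n + 1.96 * INR k - 0.967095 * INR j + 2))
  /\
  (let d2 := 0.497534 in
   INR #|OLAplus n k 2|
     <= (1 - d2) * Rpower 2 (0.119 * INR n + 1.96 * INR k - 2 * 0.967095 + 2)).
Proof.
case: n hn => [|m] // _; split=> [[|j] _|].
- by rewrite card_OLAplus0; apply/Rlt_le/Rpower2_gt0.
- apply: Rle_trans (card_OLAplusS_le m k j) _.
  rewrite -[X in _ <= X]Rmult_1_l; apply: Rmult_le_compat_r.
    exact/Rlt_le/Rpower2_gt0.
  by rewrite /weight; case: ifP; lra.
(* Position 2 is index 1 when counted from 0, where the weight is [1 - d2]. *)
have := card_OLAplusS_le m k 1; rewrite /weight /=.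
by have -> : 0.967095 * (1 + 1) = 2 * 0.967095 by ring.
Qed.
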